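(* Let $\mathcal H$ be an infinite dimensional complex Hilbert space, let $C$ be a conjugation of $\mathcal H$, and let $m\geq 1$ be an integer. Every power bounded $(m,C)$-isometric operator $S\in B(\mathcal H)$ is $(1,C)$-isometric, i.e. $S^*CSC=I$.
   Context: $B(\mathcal H)$ denotes the algebra of bounded linear operators on $\mathcal H$. An operator $S\in B(\mathcal H)$ is power bounded if there is a scalar $M>0$ with $\sup_{n\in\mathbb N}\|S^n\|<M$. A conjugation $C$ of $\mathcal H$ is an antilinear operator $C:\mathcal H\to\mathcal H$ such that $C^2=I$ and $\langle Cx,Cy\rangle=\langle y,x\rangle$ for all $x,y\in\mathcal H$. For an integer $m\geq1$, $S\in B(\mathcal H)$ is $(m,C)$-isometric if $\sum_{j=0}^m(-1)^{m-j}\binom{m}{j}S^{*j}CS^jC=0$. *)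

(* Defs.v *)
From HB Require Import structures.
From mathcomp Require Import all_boot all_order all_algebra sesquilinear.
From mathcomp Require Import all_classical all_reals all_analysis.
From mathcomp Require Import complex ring lra.
Set Implicit Arguments.
Unset Strict Implicit.
Unset Printing Implicit Defensive.

Import Order.TTheory GRing.Theory Num.Theory.
Import numFieldNormedType.Exports.
Local Open Scope classical_set_scope.
Local Open Scope ring_scope.
Local Open Scope complex_scope.

(* Inner products are linear in the first argument and conjugate-linear in the
   second; the norm of a normed module over R[i] takes its values in R[i]. *)
HB.mixin Record CompleteNormedModule_isHilbert (R : realType) H
    of CompleteNormedModule R[i] H := {
  inner : H -> H -> R[i];
  inner_linearl : forall y : H, linear_for *%R (inner^~ y);
  innerC : forall x y : H, inner x y = Num.conj (inner y x);
  inner_norm : forall x : H, inner x x = `|x| ^+ 2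
}.

#[short(type="hilbertType")]
HB.structure Definition Hilbert (R : realType) :=
  {H of CompleteNormedModule R[i] H & CompleteNormedModule_isHilbert R H}.

Notation "''[' x , y ]" := (inner x y) : ring_scope.

Section InnerProduct.
Variables (R : realType) (H : hilbertType R).
Implicit Types (x y z : H) (a : R[i]).

Lemma innerDl x y z : '[x + y, z] = '[x, z] + '[y, z].
Proof. by have := inner_linearl z 1 x y; rewrite scale1r mul1r. Qed.

Lemma inner0l z : '[0, z] = 0.
Proof. by apply: (addIr '[0, z]); rewrite -innerDl !add0r. Qed.

Lemma innerZl a x z : '[a *: x, z] = a * '[x, z].
Proof. by have := inner_linearl z a x 0; rewrite !addr0 inner0l addr0. Qed.

Lemma innerDr x y z : '[x, y + z] = '[x, y] + '[x, z].
Proof. by rewrite innerC innerDl rmorphD /= -!innerC. Qed.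

Lemma innerZr a x z : '[x, a *: z] = Num.conj a * '[x, z].
Proof. by rewrite innerC innerZl rmorphM /= -innerC. Qed.

Lemma innerBr x y z : '[x, y - z] = '[x, y] - '[x, z].
Proof. by rewrite -scaleN1r innerDr innerZr rmorphN1 mulN1r. Qed.

Let inner_hermitian x y : '[x, y] = (-1) ^+ false * Num.conj '[y, x].
Proof. by rewrite expr0 mul1r -innerC. Qed.

Let inner_gt0 x : x != 0 -> 0 < '[x, x].
Proof. by move=> x0; rewrite inner_norm exprn_gt0 ?normr_gt0. Qed.

HB.instance Definition _ := @isBilinear.Build R[i] H H R[i]
  ( *%R ) (Num.conj \; *%R) (@inner R H)
  (fun z => zmod_morphism_linear (@inner_linearl R H z)) innerBr
  (fun z a x => innerZl a x z) (fun x a z => innerZr a x z).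

HB.instance Definition _ := @isHermitianSesquilinear.Build R[i] H false Num.conj
  (@inner R H) inner_hermitian.

HB.instance Definition _ := @isDotProduct.Build R[i] H (@inner R H) inner_gt0.

End InnerProduct.

Fact cauchy_arith (R : realFieldType) (d a b c e p q : R) :
  d <= c -> b < d + q -> a < d + p -> p < e / 4%:R -> q < e / 4%:R ->
  b *+ 2 + a *+ 2 - c *+ 4 < e.
Proof. lra. Qed.
Fact minimizer_arith (R : realFieldType) (d a b c r p : R) :
  0 < c - r -> p < (c - r) ^+ 2 / 4%:R -> b < (c - r) / 2%:R ->
  c <= b + a -> 0 <= r -> 0 <= a -> d <= r ^+ 2 -> a ^+ 2 < d + p -> False.
Proof.
move=> h1 h2 h3 h4 h5 h6 h7 h8.
have h9 : (c + r) / 2 < a by lra.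
have : ((c + r) / 2) ^+ 2 < a ^+ 2 by rewrite ltr_pXn2r // nnegrE; lra.
have : 0 < (c - r) * r \/ (c-r)*r = 0.
  have : 0 <= (c - r) * r by rewrite mulr_ge0 // ltW.
  by rewrite le_eqVlt => /orP[/eqP|]; auto.
nra.
Qed.

Section Adjoint.
Variables (R : realType) (H : hilbertType R).
Implicit Types x y z : H.

Let rn x : R := complex.Re `|x|.

Let rnE x : `|x| = (rn x)%:C.
Proof. by rewrite RRe_real // ger0_real. Qed.

Let rn_ge0 x : 0 <= rn x.
Proof. by rewrite -lecR -rnE; exact: normr_ge0. Qed.

Let inner_rn x : '[x, x] = (rn x ^+ 2)%:C.
Proof. by rewrite inner_norm rnE rmorphXn. Qed.

Let dnorm_proj x k : k != 0 ->
  '[x - ('[x, k] / '[k, k]) *: k, x - ('[x, k] / '[k, k]) *: k]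
  = '[x, x] - `|'[x, k]| ^+ 2 / '[k, k].
Proof.
move=> k0; have s0 : 0 < '[k, k] by rewrite dnorm_gt0.
set c := '[x, k]; set s := '[k, k] in s0 *.
rewrite dnormB dnormZ linearZr_LR /= -/c -/s.
rewrite normf_div (gtr0_norm s0) !rmorphM /= !conjCK fmorphV /=.
rewrite (CrealP (gtr0_real s0)) exprMn exprVn normCK.
by field; rewrite gt_eqF.
Qed.

Let inner_bound x k : `|'[x, k]| <= `|x| * `|k|.
Proof.
have [->|k0] := eqVneq k 0; first by rewrite linear0r !normr0 mulr0.
have s0 : 0 < '[k, k] by rewrite dnorm_gt0.
rewrite -(ler_pXn2r (_ : (0 < 2)%N)) ?nnegrE ?mulr_ge0 // exprMn -!inner_norm.
by rewrite -ler_pdivrMr // -subr_ge0 -dnorm_proj // dnorm_ge0.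
Qed.

Let parallelogram x y :
  rn (x - y) ^+ 2 =
  rn x ^+ 2 *+ 2 + rn y ^+ 2 *+ 2 - rn (2^-1 *: (x + y)) ^+ 2 *+ 4.
Proof.
apply: complexI; rewrite rmorphB rmorphD !rmorphMn /= -!inner_rn.
rewrite dnormB dnormZ dnormD ger0_norm ?invr_ge0 //.
rewrite /=; move: '[x, x] '[y, y] '[x, y] => b c e.
move: (Num.conj e) => a.
by field.
Qed.

Lemma riesz (f : H -> R[i]) : linear_for *%R f ->
  (exists2 M : R, 0 < M & forall x : H, `|f x| <= M%:C * `|x|) ->
  exists z : H, forall x : H, f x = '[x, z].
Proof.
move=> flin [M M0 fM].
have fD x y : f (x + y) = f x + f y.
  by have := flin 1 x y; rewrite scale1r mul1r.
have f0 : f 0 = 0 by apply: (addIr (f 0)); rewrite -fD !add0r.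
have fZ a x : f (a *: x) = a * f x.
  by have := flin a x 0; rewrite !addr0 f0 addr0.
have fB x y : f (x - y) = f x - f y by rewrite fD -scaleN1r fZ mulN1r.
have [[x1 fx1]|nz] := pselect (exists x, f x != 0); last first.
  exists 0 => x; rewrite linear0r; apply/eqP/negPn/negP => fx.
  by apply: nz; exists x.
pose A := [set x | f x = 1].
pose B := [set rn x ^+ 2 | x in A].
have B0 : has_inf B.
  split; last by exists 0 => _ [x _ <-]; rewrite sqr_ge0.
  exists (rn ((f x1)^-1 *: x1) ^+ 2); exists ((f x1)^-1 *: x1) => //.
  by rewrite /A /= fZ mulVf.
pose d := inf B.
have dle x : f x = 1 -> d <= rn x ^+ 2.
  by move=> fx; apply: ge_inf; [exact: B0.2 | exists x].
have /choice[u uP] : forall n : nat,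
    exists x, f x = 1 /\ rn x ^+ 2 < d + n.+1%:R^-1.
  move=> n; have n0 : 0 < n.+1%:R^-1 :> R by rewrite invr_gt0.
  have [_ [x fx <-] xd] := inf_adherent n0 B0.
  by exists x.
have near_small (e : R) : 0 < e -> exists n0 : nat, forall n, (n0 <= n)%N ->
    n.+1%:R^-1 < e.
  move=> e0; exists (Num.truncn e^-1) => n nn.
  rewrite -[e]invrK ltf_pV2 ?posrE ?invr_gt0 ?ltr0n //.
  apply: lt_le_trans (truncnS_gt _) _; by rewrite ler_nat.
have cu : cvg (u @ \oo).
  apply: cauchy_cvg; apply: cauchy_exP => eps eps0.
  have epsE : eps = (complex.Re eps)%:C by rewrite RRe_real // gtr0_real.
  set e := complex.Re eps in epsE.
  have e0 : 0 < e by rewrite -ltcR -epsE.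
  have [|n0 n0P] := near_small (e ^+ 2 / 4%:R).
    by rewrite divr_gt0 ?exprn_gt0 ?ltr0n.
  exists (u n0); exists n0 => // n /= nn.
  rewrite -ball_normE /= epsE rnE ltcR.
  rewrite -(ltr_pXn2r (_ : (0 < 2)%N)) ?nnegrE ?rn_ge0 ?ltW //.
  rewrite parallelogram.
  apply: (@cauchy_arith _ d _ _ _ _ n.+1%:R^-1 n0.+1%:R^-1); last 1 first.
  - exact: n0P.
  - apply: dle; rewrite fZ fD (uP n).1 (uP n0).1 -[1 + 1]/(2%:R) mulVf //.
  - exact: (uP n0).2.
  - exact: (uP n).2.
  - exact: n0P.
pose l := lim (u @ \oo).
have ul : u @ \oo --> l by [].
have fl : f l = 1.
  apply/eqP; rewrite -subr_eq0; apply/eqP/normr0_eq0/eqP.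
  rewrite eq_le normr_ge0 andbT.
  have -> : `|f l - 1| = (complex.Re `|f l - 1|)%:C.
    by rewrite RRe_real // ger0_real.
  rewrite lecR; apply/ler_addgt0Pl => e e0; rewrite addr0.
  have /cvgrPdist_lt /(_ (e / M)%:C) [|n _ /(_ n (leqnn n)) /= nP] := ul.
    by rewrite ltcR divr_gt0.
  rewrite rnE ltcR ltr_pdivlMr // in nP.
  have : `|f l - 1| <= e%:C.
    rewrite -(uP n).1 -fB (le_trans (fM _)) //.
    by rewrite rnE -rmorphM /= lecR mulrC ltW.
  by rewrite -lecR.
have lmin y : f y = 1 -> rn l ^+ 2 <= rn y ^+ 2.
  move=> fy; rewrite leNgt; apply/negP => yl.
  have {}yl : rn y < rn l.
    by move: yl; rewrite ltr_pXn2r ?nnegrE ?rn_ge0.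
  pose e := rn l - rn y.
  have e0 : 0 < e by rewrite subr_gt0.
  have [|n0 n0P] := near_small (e ^+ 2 / 4%:R).
    by rewrite divr_gt0 ?exprn_gt0 ?ltr0n.
  have /cvgrPdist_lt /(_ (e / 2)%:C) [|n1 _ n1P] := ul.
    by rewrite ltcR divr_gt0.
  pose n := maxn n0 n1.
  have /n0P h0 : (n0 <= n)%N by exact: leq_maxl.
  have /n1P /= h1 : (n1 <= n)%N by exact: leq_maxr.
  rewrite rnE ltcR in h1.
  have tri : rn l <= rn (l - u n) + rn (u n).
    rewrite -lecR rmorphD /= -!rnE.
    by apply: le_trans (ler_normD _ _); rewrite subrK.
  apply: (@minimizer_arith _ d (rn (u n)) (rn (l - u n)) (rn l) (rn y));
    [exact: e0 | exact: h0 | exact: h1 | exact: tri | by [] | by []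
    | exact: dle | exact: (uP n).2].
have orth k : f k = 0 -> '[l, k] = 0.
  move=> fk; have [->|k0] := eqVneq k 0; first by rewrite linear0r.
  have s0 : 0 < '[k, k] by rewrite dnorm_gt0.
  set c := '[l, k]; set s := '[k, k] in s0.
  have := lmin (l - (c / s) *: k).
  rewrite fB fl fZ fk mulr0 subr0 => /(_ erefl).
  rewrite -lecR -!inner_rn dnorm_proj //.
  rewrite lerBrDr gerDl pmulr_lle0 ?invr_gt0 // => h.
  apply/eqP; rewrite -normr_eq0 -sqrf_eq0 eq_le h /=.
  by rewrite exprn_ge0.
have l0 : '[l, l] != 0.
  rewrite dnorm_eq0; apply/eqP => l0; move: fl; rewrite l0 f0 => /esym/eqP.
  by rewrite oner_eq0.
exists ('[l, l]^-1 *: l) => x.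
rewrite linearZr_LR /= fmorphV /= -innerC.
have : '[l, x - f x *: l] = 0 by apply: orth; rewrite fB fZ fl mulr1 subrr.
rewrite linearBr linearZr_LR /= => /eqP; rewrite subr_eq0 => /eqP h.
rewrite [in RHS](innerC x) h rmorphM /= conjCK -innerC.
by rewrite mulrCA mulVf ?mulr1.
Qed.

(* The adjoint is chosen by its defining property; [adjointP] shows that this
   property holds for every bounded linear operator. *)
Definition adjoint (S : H -> H) : H -> H :=
  get [set T | forall x y : H, '[S x, y] = '[x, T y]].

Lemma adjointP (S : {linear H -> H}) : bounded_near S (nbhs (0 : H)) ->
  forall x y : H, '[S x, y] = '[x, adjoint S y].
Proof.
move=> Sb.
suff : exists T : H -> H, forall x y : H, '[S x, y] = '[x, T y].
  move=> [T TP].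
  by apply: (@getPex _ [set T | forall x y, '[S x, y] = '[x, T y]]); exists T.
have /choice[T TP] : forall y : H, exists z, forall x, '[S x, y] = '[x, z].
  move=> y; apply: riesz => [a x1 x2|]; first by rewrite linearP inner_linearl.
  have /linear_boundedP/pinfty_ex_gt0[M M0 SM] := Sb.
  pose b := complex.Re M * rn y + 1.
  have ME : M = (complex.Re M)%:C by rewrite RRe_real ?gtr0_real.
  exists b => [|x].
    by rewrite ltr_wpDl // mulr_ge0 // -lecR -ME ltW.
  apply: le_trans (inner_bound _ _) _.
  rewrite rmorphD rmorphM /= -ME -rnE mulrDl mul1r.
  by rewrite ler_wpDr // mulrAC ler_wpM2r.
by exists T => x y; exact: TP.
Qed.
End Adjoint.

Section Operators.
Variables (R : realType) (H : hilbertType R).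
Implicit Types S C : H -> H.

Definition infinite_dimensional : Prop :=
  ~ exists n (v : 'I_n -> H),
      forall x : H, exists a : 'I_n -> R[i], x = \sum_(i < n) a i *: v i.

(* [complex.Re] only transports the real number `|S x| from R[i] to R. *)
Definition operator_norm S : \bar R :=
  ereal_sup [set (complex.Re `|S x|)%:E | x in [set x : H | `|x| <= 1]].

Definition power_bounded S : Prop :=
  exists2 M : R, 0 < M &
    (ereal_sup (range (fun n => operator_norm (iter n S))) < M%:E)%E.

Definition conjugation C : Prop :=
  [/\ linear_for (Num.conj \; *:%R) C,
      (forall x : H, C (C x) = x)
    & forall x y : H, '[C x, C y] = '[y, x]].

Definition mC_isometric (m : nat) C S : Prop :=
  forall x : H,
    \sum_(j < m.+1)
      ((-1) ^+ (m - j) * 'C(m, j)%:R) *: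
        iter j (adjoint S) (C (iter j S (C x))) = 0.

End Operators.

Arguments infinite_dimensional {R} H.

(* Main.v *)
Require Import Defs.
From mathcomp Require Import all_boot all_order all_algebra sesquilinear.
From mathcomp Require Import all_classical all_reals all_analysis.
From mathcomp Require Import complex.
Import Order.TTheory GRing.Theory Num.Theory.
Import numFieldNormedType.Exports.
Local Open Scope classical_set_scope.
Local Open Scope ring_scope.

(** Fix vectors [y] and [u] and put [a n = <S^n y, C S^n u>].  Moving powers of
    the adjoint to the other side of the inner product turns the
    [(m, C)]-isometry equation, evaluated at [C S^n u] and paired with [S^n y],
    into the vanishing of the [m]-th forward difference of [a] at [n].  So [a]
    is a polynomial sequence of degree less than [m].  Power boundedness of [S],
    together with the fact that [C] preserves norms, makes [a] bounded, and a
    bounded polynomial sequence is constant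
    ([bounded_finite_difference_constant]).  The equality [a 1 = a 0] reads
    [<S y, C S u> = <y, C u>]; taking [u = C x] and letting [y] vary gives
    [S^* C S C x = x]. *)

Definition finite_difference {V : pzRingType} (m : nat) (a : nat -> V) (n : nat) : V :=
  \sum_(j < m.+1) ((-1) ^+ (m - j) * 'C(m, j)%:R) * a (n + j)%N.

Lemma finite_difference0 {V : pzRingType} (a : nat -> V) n :
  finite_difference 0 a n = a n.
Proof. by rewrite /finite_difference big_ord1 bin0 expr0 !mul1r addn0. Qed.

(** Pascal's rule: the binomial sum is the iterate of the difference operator
    that its name suggests. *)
Lemma finite_differenceS {V : pzRingType} m (a : nat -> V) n :
  finite_difference m.+1 a n = finite_difference m (fun k => a k.+1 - a k) n.
Proof.
rewrite /finite_difference.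
under [RHS]eq_bigr do rewrite mulrBr.
rewrite sumrB big_ord_recl /= bin0 subn0 addn0 mulr1.
under eq_bigr => i _ do
  rewrite /bump /= add1n subSS binS natrD mulrDr mulrDl addnS.
rewrite big_split /= addrA [RHS]addrC.
congr (_ + _).
(* the top term of the first sum carries 'C(m, m.+1) = 0 *)
rewrite big_ord_recr /= bin_small // mulr0 mul0r addr0.
rewrite [in RHS]big_ord_recl /= bin0 subn0 addn0 mulr1 opprD exprS mulN1r mulNr.
congr (_ + _); rewrite -sumrN; apply: eq_bigr => i _.
by rewrite /bump /= add1n addnS -[(m - i)%N]subnSK // exprS mulN1r !mulNr.
Qed.

(** A bounded arithmetic progression is constant, by the Archimedean property;
    it is applied to the real number [`|d|]. *)
Lemma bounded_arithmetic_step0 {R : realType} (a : nat -> R[i]) (d : R[i]) (K : R) :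
  (forall n, a n.+1 - a n = d) -> (forall n, `|a n| <= K%:C%C) -> d = 0.
Proof.
move=> ad aK; have aE n : a n - a 0%N = d *+ n.
  by elim: n => [|n IH]; rewrite ?subrr // mulrS -IH -(ad n) addrA subrK.
have rE : `|d| = (complex.Re `|d|)%:C%C by rewrite RRe_real // ger0_real.
set r := complex.Re _ in rE.
have r0 : 0 <= r by rewrite -lecR -rE; exact: normr_ge0.
have nrK n : r *+ n <= K + K.
  rewrite -lecR rmorphMn rmorphD /= -rE -normrMn -aE.
  by apply: le_trans (ler_normB _ _) _; exact: lerD.
apply/normr0_eq0; rewrite rE; suff -> : r = 0 by [].
apply/eqP; rewrite eq_le r0 andbT leNgt; apply/negP => rgt0.
have := nrK (Num.truncn ((K + K) / r)).+1.
rewrite -mulr_natl -ler_pdivlMr // leNgt => /negP; apply.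
exact: truncnS_gt.
Qed.

(** Applied to the differences of [a], the induction hypothesis says that [a] is
    an arithmetic progression. *)
Lemma bounded_finite_difference_constant {R : realType} m (a : nat -> R[i]) (K : R) :
  (forall n, `|a n| <= K%:C%C) -> (forall n, finite_difference m a n = 0) ->
  forall n, a n.+1 = a n.
Proof.
elim: m a K => [|m IH] a K aK am n.
  by rewrite -(finite_difference0 a n) -(finite_difference0 a n.+1) !am.
pose b k := a k.+1 - a k.
have bK k : `|b k| <= (K + K)%:C%C.
  by rewrite rmorphD /=; apply: le_trans (ler_normB _ _) _; exact: lerD.
have bS k : b k.+1 = b k.
  by apply: IH bK _ _ => i; rewrite -finite_differenceS.
have bE k : b k = b 0%N by elim: k => // k <-.
apply/eqP; rewrite -subr_eq0; apply/eqP; rewrite -/(b n) bE.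
exact: bounded_arithmetic_step0 bE aK.
Qed.

(** With [c = <x, y>] and [e = c / |c|], this is the inequality
    [0 <= |x - e y|^2]; the phase [e] turns the cross terms into [2 |c|]. *)
Lemma inner_le_sqr {R : realType} {H : hilbertType R} (x y : H) :
  `|'[x, y]| *+ 2 <= `|x| ^+ 2 + `|y| ^+ 2.
Proof.
set c := '[x, y].
have [->|c0] := eqVneq c 0; first by rewrite normr0 mul0rn addr_ge0 ?exprn_ge0.
have n0 : `|c| != 0 by rewrite normr_eq0.
have := dnorm_ge0 (@inner R H) (x - (c / `|c|) *: y).
rewrite dnormB dnormZ linearZr_LR /= -/c !inner_norm.
have -> : Num.conj (c / `|c|) * c = `|c|.
  rewrite rmorphM /= fmorphV /= (CrealP (normr_real c)) mulrAC.
  by rewrite [_ * c]mulrC -normCK expr2 mulfK.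
rewrite normf_div normr_id divff // expr1n mul1r (CrealP (normr_real c)).
by rewrite -mulr2n subr_ge0.
Qed.

Lemma conjugation_norm {R : realType} {H : hilbertType R} (C : H -> H) (x : H) :
  conjugation C -> `|C x| = `|x|.
Proof.
move=> [_ _ Cinner]; apply/eqP.
by rewrite -(@eqrXn2 _ 2) // -!inner_norm Cinner.
Qed.

(** The supremum bounds [|S^n x|] for [x] in the unit ball; other vectors are
    reached by scaling. *)
Lemma power_bounded_orbit {R : realType} {H : hilbertType R}
    (S : {linear H -> H}) (x : H) :
  power_bounded S -> exists K : R, forall n, `|iter n S x| <= K%:C%C.
Proof.
move=> [M M0 SM].
have normE (z : H) : `|z| = (complex.Re `|z|)%:C%C.
  by rewrite RRe_real // ger0_real.
have iterZ c z n : iter n S (c *: z) = c *: iter n S z.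
  by elim: n => //= n ->; rewrite linearZ.
have ball n z : `|z| <= 1 -> `|iter n S z| <= M%:C%C.
  move=> z1; rewrite normE lecR -lee_fin; apply: le_trans (ltW SM).
  apply: (@le_trans _ _ (operator_norm (iter n S))).
    by apply: ereal_sup_ubound; exists z.
  by apply: ereal_sup_ubound; exists n.
exists (complex.Re `|x| * M) => n.
have [->|x0] := eqVneq x 0.
  suff -> : iter n S 0 = 0 by rewrite normr0 /= mul0r.
  by rewrite -{1}(scale0r (0 : H)) iterZ scale0r.
have nx : `|x| != 0 by rewrite normr_eq0.
have -> : x = `|x| *: (`|x|^-1 *: x) by rewrite scalerA divff // scale1r.
rewrite iterZ normrZ normr_id rmorphM /= -!normE.
rewrite scalerA divff // scale1r ler_wpM2l // ball //.
by rewrite normrZ normfV normr_id mulVf.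
Qed.

Lemma inner_iter_adjoint {R : realType} {H : hilbertType R} (S : {linear H -> H}) :
  bounded_near S (nbhs (0 : H)) ->
  forall n (x y : H), '[iter n S x, y] = '[x, iter n (adjoint S) y].
Proof.
by move=> Sb; elim=> //= n IH x y; rewrite adjointP // IH -iterSr.
Qed.

(** Pairing the defining identity at [C S^n u] with [S^n y] shifts both orbits
    by [n]; the binomial coefficients, being real, pass through the
    conjugate-linear argument unchanged. *)
Lemma mC_isometric_finite_difference {R : realType} {H : hilbertType R}
    (C : H -> H) m (S : {linear H -> H}) (y u : H) n :
  conjugation C -> bounded_near S (nbhs (0 : H)) -> mC_isometric m C S ->
  finite_difference m (fun k => '[iter k S y, C (iter k S u)]) n = 0.
Proof.
move=> [_ CC _] Sb Siso.
have := congr1 (fun z => '[iter n S y, z]) (Siso (C (iter n S u))).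
rewrite linear_sumr linear0r => <-; apply: eq_bigr => j _.
rewrite linearZr_LR /= rmorphM rmorphXn rmorphN1 rmorph_nat CC.
by rewrite -inner_iter_adjoint // -!iterD addnC.
Qed.

Lemma power_bounded_mC_isometric_inner {R : realType} {H : hilbertType R}
    (C : H -> H) m (S : {linear H -> H}) (y u : H) :
  conjugation C -> bounded_near S (nbhs (0 : H)) ->
  power_bounded S -> mC_isometric m C S ->
  '[S y, C (S u)] = '[y, C u].
Proof.
move=> HC Sb Sp Siso.
have [K yK] := power_bounded_orbit S y Sp.
have [L uL] := power_bounded_orbit S u Sp.
pose a k := '[iter k S y, C (iter k S u)].
have aK k : `|a k| <= (K ^+ 2 + L ^+ 2)%:C%C.
  apply: (@le_trans _ _ (`|a k| *+ 2)); first by rewrite mulr2n lerDl.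
  apply: le_trans (inner_le_sqr _ _) _.
  rewrite (conjugation_norm _ _ HC) rmorphD !rmorphXn /=.
  by apply: lerD; rewrite lerXn2r // nnegrE // (le_trans _ (yK k), le_trans _ (uL k)).
apply: (bounded_finite_difference_constant m a _ aK _ 0%N) => n.
exact: mC_isometric_finite_difference.
Qed.

Theorem proposition2p8 (R : realType) (H : hilbertType R)
    (Hinf : infinite_dimensional H)
    (C : H -> H) (HC : conjugation C)
    (m : nat) (hm : (1 <= m)%N)
    (S : {linear H -> H}) (Sbounded : bounded_near S (nbhs (0 : H)))
    (Spower : power_bounded S) (Siso : mC_isometric m C S) :
  mC_isometric 1 C S /\ (forall x : H, adjoint S (C (S (C x))) = x).
Proof.
have [_ CC _] := HC.
have SCSC x : adjoint S (C (S (C x))) = x.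
  apply/eqP; rewrite -subr_eq0 -(dnorm_eq0 (@inner R H)) linearBr /= subr_eq0.
  rewrite -adjointP // (power_bounded_mC_isometric_inner C m) //.
  by rewrite CC.
split=> // x; rewrite big_ord_recl big_ord1 /= /bump /= SCSC CC subn0 addn0 subnn.
by rewrite !bin0 binn expr1 expr0 !mulr1 scale1r scaleN1r addNr.
Qed.
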